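(* Consider a stochastic process $\{\mathbf{x}_k\}$, $\mathbf{x}_k\in\mathbb{R}$. Denote the $1$-step (ahead) prediction of $\mathbf{x}_k$ by $\widehat{\mathbf{x}}_k=f_k(\mathbf{x}_{0,\ldots,k-1})$, where $f_k$ is a measurable function. Then $$\mathrm{D}_{\max}(\mathbf{x}_k-\widehat{\mathbf{x}}_k)\;\ge\;2^{h(\mathbf{x}_k\mid\mathbf{x}_{0,\ldots,k-1})-1},$$ where equality holds if and only if $\mathbf{x}_k-\widehat{\mathbf{x}}_k$ is uniform and $I(\mathbf{x}_k-\widehat{\mathbf{x}}_k;\mathbf{x}_{0,\ldots,k-1})=0$.
   Context: Notation: $\mathbf{x}_{0,\ldots,k-1}=[\mathbf{x}_0,\ldots,\mathbf{x}_{k-1}]^T$. Logarithms have base $2$; $h(\cdot\mid\cdot)$ is conditional differential entropy and $I(\cdot;\cdot)$ is mutual information. Random variables and vectors are real-valued and continuous, with supports that are compact if bounded, and all of them (including $\mathbf{x}_k$ and $\widehat{\mathbf{x}}_k$) are zero-mean. For a zero-mean random variable $\mathbf{e}$ with support $\mathrm{supp}(\mathbf{e})$, the maximum deviation is $\mathrm{D}_{\max}(\mathbf{e})=\max_{e\in\mathrm{supp}(\mathbf{e})}|e|$ (infinite if the support is unbounded). A random variable with compact support of length (volume) in $(0,\infty)$ is called uniform if it is uniformly distributed over its support.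
   Formalization: ''Uniform'' is taken to mean uniform over a compact interval; for arbitrary compact support the ''if'' direction fails, e.g. an error uniform on [-2,-1]∪[1,2] and independent of the past has maximum deviation 2 but bound 1. *)

(* Defs.v *)
From HB Require Import structures.
From mathcomp Require Import all_boot all_order all_algebra.
From mathcomp Require Import all_classical all_reals all_analysis.
From mathcomp Require Import measurable_realfun.

Set Implicit Arguments.
Unset Strict Implicit.
Unset Printing Implicit Defensive.

Import Order.TTheory GRing.Theory Num.Theory.
Import numFieldNormedType.Exports.

Local Open Scope classical_set_scope.
Local Open Scope ring_scope.

(* lebesgue_measure, registered as a measure for the default sigma-algebra of R
   (the library registers it on the alias measurableTypeR R only). *)
Definition lebesgue_line (R : realType) : set R -> \bar R := @lebesgue_measure R.
Arguments lebesgue_line R _ : clear implicits.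

Section lebesgue_line_measure.
Variable R : realType.

Let lebesgue_line0 : lebesgue_line R set0 = 0%E.
Proof. exact: (measure0 (@lebesgue_measure R)). Qed.

Let lebesgue_line_ge0 A : (0 <= lebesgue_line R A)%E.
Proof. exact: (measure_ge0 (@lebesgue_measure R)). Qed.

Let lebesgue_line_sigma_additive : semi_sigma_additive (lebesgue_line R).
Proof. exact: (@measure_semi_sigma_additive _ _ _ (@lebesgue_measure R)). Qed.

HB.instance Definition _ := isMeasure.Build _ _ _ (lebesgue_line R)
  lebesgue_line0 lebesgue_line_ge0 lebesgue_line_sigma_additive.

Let sigma_finite_lebesgue_line : sigma_finite [set: R] (lebesgue_line R).
Proof. exact: (sigma_finiteT (@lebesgue_measure R)). Qed.

HB.instance Definition _ := Measure_isSigmaFinite.Build _ _ _ (lebesgue_line R)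
  sigma_finite_lebesgue_line.

End lebesgue_line_measure.

(* The library infers sigma-finiteness of m1 \x m2 only when m1 and m2 are
   (sub)probabilities; prod_measure is the same set function with the instance
   needed for arbitrary sigma-finite factors. *)
Section prod_measure.
Context d1 d2 (T1 : measurableType d1) (T2 : measurableType d2) (R : realType).
Variables (m1 : {sigma_finite_measure set T1 -> \bar R}).
Variables (m2 : {sigma_finite_measure set T2 -> \bar R}).

Definition prod_measure : set (T1 * T2) -> \bar R := (m1 \x m2)%E.

Let prod_measure0 : prod_measure set0 = 0%E.
Proof. exact: (measure0 (m1 \x m2)%E). Qed.

Let prod_measure_ge0 A : (0 <= prod_measure A)%E.
Proof. exact: (measure_ge0 (m1 \x m2)%E). Qed.

Let prod_measure_sigma_additive : semi_sigma_additive prod_measure.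
Proof. exact: (@measure_semi_sigma_additive _ _ _ (m1 \x m2)%E). Qed.

HB.instance Definition _ := isMeasure.Build _ _ _ prod_measure
  prod_measure0 prod_measure_ge0 prod_measure_sigma_additive.

Let sigma_finite_prod_measure : sigma_finite [set: T1 * T2] prod_measure.
Proof.
have /sigma_finiteP[F [TF ndF Foo]] := sigma_finiteT m1.
have /sigma_finiteP[G [TG ndG Goo]] := sigma_finiteT m2.
exists (fun n => F n `*` G n).
  rewrite -setXTT TF TG predeqE => -[x y]; split.
    move=> [/= [n _ Fnx] [k _ Gky]]; exists (maxn n k) => //; split.
    - by move: x Fnx; exact/subsetPset/ndF/leq_maxl.
    - by move: y Gky; exact/subsetPset/ndG/leq_maxr.
  by move=> [n _ []/= ? ?]; split; exists n.
move=> k; have [? ?] := Foo k; have [? ?] := Goo k.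
split; first exact: measurableX.
by rewrite /prod_measure product_measure1E// lte_mul_pinfty// ge0_fin_numE.
Qed.

HB.instance Definition _ := Measure_isSigmaFinite.Build _ _ _ prod_measure
  sigma_finite_prod_measure.

End prod_measure.

Section lebesgue_tuple.
Context {R : realType}.

Section rcons.
Variables (n : nat).
Variable m : {sigma_finite_measure set (n.-tuple R) -> \bar R}.

Definition rcons_pair (p : n.-tuple R * R) :
  n.+1.-tuple R := [tuple of rcons p.1 p.2].

Lemma measurable_rcons_pair : measurable_fun [set: _] rcons_pair.
Proof.
apply/measurable_fun_tnthP => i; case: (ltnP i n) => [lt_in|le_ni].
  rewrite (_ : _ \o _ = (fun t => tnth t (Ordinal lt_in)) \o fst).
    by apply: measurableT_comp => //; exact: measurable_tnth.
  apply/funext => -[t r] /=; rewrite (tnth_nth 0) /= nth_rcons size_tuple lt_in.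
  by rewrite (tnth_nth 0).
rewrite (_ : _ \o _ = snd) //.
apply/funext => -[t r] /=; rewrite (tnth_nth 0) /= nth_rcons size_tuple.
have -> : i = n :> nat by apply/eqP; rewrite eqn_leq le_ni -ltnS ltn_ord.
by rewrite ltnn eqxx.
Qed.

Definition lebesgue_rcons : set (n.+1.-tuple R) -> \bar R :=
  pushforward (prod_measure m (lebesgue_line R)) rcons_pair.

Let lebesgue_rcons0 : lebesgue_rcons set0 = 0%E.
Proof. by rewrite /lebesgue_rcons /pushforward preimage_set0 measure0. Qed.

Let lebesgue_rcons_ge0 A : (0 <= lebesgue_rcons A)%E.
Proof. by rewrite /lebesgue_rcons /pushforward. Qed.

Let lebesgue_rcons_sigma_additive : semi_sigma_additive lebesgue_rcons.
Proof.
exact: (@measure_semi_sigma_additive _ _ _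
  (measure_function_pushforward__canonical__measure_function_Measure
     (prod_measure m (lebesgue_line R)) measurable_rcons_pair)).
Qed.

HB.instance Definition _ := isMeasure.Build _ _ _ lebesgue_rcons
  lebesgue_rcons0 lebesgue_rcons_ge0 lebesgue_rcons_sigma_additive.

Let sigma_finite_lebesgue_rcons : sigma_finite [set: _] lebesgue_rcons.
Proof.
have [F FT Foo] := sigma_finiteT (prod_measure m (lebesgue_line R)).
pose g (t : n.+1.-tuple R) :
    n.-tuple R * R :=
  ([tuple tnth t (widen_ord (leqnSn n) i) | i < n], tnth t ord_max).
have mg : measurable_fun [set: _] g.
  apply: measurable_fun_pair; last exact: measurable_tnth.
  apply/measurable_fun_tnthP => i.
  rewrite (_ : _ \o _ = fun t => tnth t (widen_ord (leqnSn n) i)).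
    exact: measurable_tnth.
  by apply/funext => t /=; rewrite tnth_mktuple.
have gK : cancel rcons_pair g.
  move=> [t r]; rewrite /g; congr (_, _).
    apply: eq_from_tnth => i; rewrite tnth_mktuple !(tnth_nth 0) /=.
    by rewrite nth_rcons size_tuple ltn_ord.
  by rewrite (tnth_nth 0) /= nth_rcons size_tuple ltnn eqxx.
exists (fun k => g @^-1` F k).
  by rewrite -preimage_bigcup -FT preimage_setT.
move=> k; have [mF Fk] := Foo k; split.
  by rewrite -[X in measurable X]setTI; exact: mg.
rewrite /lebesgue_rcons /pushforward -comp_preimage.
by rewrite (_ : g \o rcons_pair = id) //; apply/funext => p /=; rewrite gK.
Qed.

HB.instance Definition _ :=
  Measure_isSigmaFinite.Build _ _ _ lebesgue_rcons sigma_finite_lebesgue_rcons.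

End rcons.

(* Lebesgue measure on R^n: the only point of R^0 has mass 1, and
   R^n.+1 = R^n x R carries the product measure. *)
Fixpoint lebesgue_tuple n :
    {sigma_finite_measure set (n.-tuple R) -> \bar R} :=
  match n with
  | 0 => \d_[tuple]
  | n'.+1 => lebesgue_rcons (lebesgue_tuple n')
  end.

End lebesgue_tuple.
Arguments lebesgue_tuple R n : clear implicits.

Section random_vectors.
Context d (T : measurableType d) (R : realType).

Section pair.
Context d1 d2 (T1 : measurableType d1) (T2 : measurableType d2).
Variables (X : {mfun T >-> T1}) (Y : {mfun T >-> T2}).

Definition rv_pair (w : T) : T1 * T2 := (X w, Y w).

Lemma measurable_rv_pair : measurable_fun [set: T] rv_pair.
Proof. by apply: measurable_fun_pair; exact: measurable_funPT. Qed.

HB.instance Definition _ :=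
  @isMeasurableFun.Build _ _ _ _ rv_pair measurable_rv_pair.

End pair.

Section past.
Variables (x : nat -> {mfun T >-> R}) (k : nat).

Definition past (w : T) : k.-tuple R :=
  [tuple x i w | i < k].

Lemma measurable_past : measurable_fun [set: T] past.
Proof.
apply/measurable_fun_tnthP => i; rewrite (_ : _ \o _ = x i).
  exact: measurable_funPT.
by apply/funext => w /=; rewrite tnth_mktuple.
Qed.

HB.instance Definition _ :=
  @isMeasurableFun.Build _ _ _ _ past measurable_past.

End past.

End random_vectors.

Section information.
Context d (T : measurableType d) (R : realType) (P : probability T R).

Definition log2 (r : R) : R := ln r / ln 2.

Definition exp2e (a : \bar R) : \bar R :=
  match a with
  | r%:E => (2 `^ r)%:E
  | +oo%E => +oo%E
  | -oo%E => 0%E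
  end.

Section density.
Context d1 (T1 : measurableType d1).
Variables (mu : {sigma_finite_measure set T1 -> \bar R}) (X : {mfun T >-> T1}).

Definition has_density : Prop := distribution P X `<< mu.

Definition density (t : T1) : R :=
  fine (Radon_Nikodym (charge_of_finite_measure (distribution P X)) mu t).

End density.

Section joint.
Context d1 d2 (T1 : measurableType d1) (T2 : measurableType d2).
Variables (mu : {sigma_finite_measure set T1 -> \bar R}).
Variables (nu : {sigma_finite_measure set T2 -> \bar R}).
Variables (X : {mfun T >-> T1}) (Y : {mfun T >-> T2}).

Let fXY := density (prod_measure mu nu) (rv_pair X Y).
Let fX := density mu X.
Let fY := density nu Y.

(* h(X | Y) = - \int f(x, y) log f(x | y), where f(x | y) = f(x, y) / f(y);
   the value may be -oo *)
Definition cond_diff_entropy : \bar R :=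
  (- \int[prod_measure mu nu]_z (fXY z * log2 (fXY z / fY z.2))%:E)%E.

Definition mutual_information : \bar R :=
  (\int[prod_measure mu nu]_z (fXY z * log2 (fXY z / (fX z.1 * fY z.2)))%:E)%E.

End joint.

Section real_valued.
Variable X : {mfun T >-> R}.

Definition zero_mean : Prop :=
  P.-integrable [set: T] (EFin \o X) /\ ('E_P[X] = 0)%E.

Definition rv_support : set R :=
  [set t | forall U : set R, open U -> U t -> (0 < distribution P X U)%E].

(* The support is closed, so the supremum is attained when it is bounded; it is
   +oo when the support is unbounded. *)
Definition max_deviation : \bar R :=
  ereal_sup [set `|t|%:E | t in rv_support].

(* The support is required to be an interval: for the uniform law on
   [-2, -1] `|` [1, 2], whose length is 2, the maximum deviation is 2 although
   2 `^ (h - 1) = 1. *)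
Definition uniform_rv : Prop :=
  [/\ compact rv_support, is_interval rv_support,
      (0 < lebesgue_line R rv_support < +oo)%E
    & forall A : set R, measurable A ->
      (distribution P X A * lebesgue_line R rv_support =
       lebesgue_line R (A `&` rv_support))%E].

End real_valued.

End information.

Section prediction.
Context d (T : measurableType d) (R : realType).
Variables (x : nat -> {mfun T >-> R}) (k : nat).
Variable f : {mfun k.-tuple R >-> R}.

Definition prediction : {mfun T >-> R} := f \o past x k.

Definition prediction_error : {mfun T >-> R} := x k \- prediction.

End prediction.

(* Main.v *)
(* Write Y for the past, E = x_k - f(Y) for the error and D for its maximum
   deviation.  The shear (x, y) |-> (x - f y, y) preserves Lebesgue measure on
   R x R^k, so h(x_k | Y) = h(E | Y).  If D < +oo, let c be the uniform density on
   [-D, D]; comparing the density p of (E, Y) with q(e, y) = c(e) f_Y(y) gives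
     h(E | Y) = log (2 D) - KL(p || q),
   and Gibbs' inequality yields the bound, with equality iff p = q a.e., that is,
   iff E is uniform on [-D, D] and independent of Y.  Likewise I(E; Y) is the
   divergence of p from f_E f_Y, and a zero-mean uniform variable lives on a
   symmetric interval.  If D = +oo the bound is trivial, and it is strict because
   the comparison density exp(-|e|) together with the integrability of E shows
   h(E | Y) < +oo. *)
Require Import Defs.
From mathcomp Require Import all_boot all_order all_algebra.
From mathcomp Require Import all_classical all_reals all_analysis.
From mathcomp Require Import measurable_realfun.
From mathcomp Require Import ring lra.

Set Implicit Arguments.
Unset Strict Implicit.
Unset Printing Implicit Defensive.

Import Order.TTheory GRing.Theory Num.Theory.
Import numFieldNormedType.Exports.

Local Open Scope classical_set_scope.
Local Open Scope ring_scope.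
Local Open Scope ereal_scope.

(** * Gibbs' inequality and relative entropy *)

Section measurable_ratio.
Context d (T : measurableType d) (R : realType).

Lemma measurable_invr : measurable_fun setT (fun x : R => x^-1%R).
Proof.
(* The new form is a composition of measurable maps. It is also correct at 0, where the inverse is 0
   by convention. *)
rewrite (_ : (fun _ => _) = fun x : R => (x * expR (- ln (x * x)))%R).
  apply: measurable_funM => //; apply: measurableT_comp.
    exact: measurable_expR.
  apply: measurableT_comp => //; apply: measurableT_comp.
    exact: measurable_ln.
  exact: measurable_funM.
apply/funext => x; have [->|x0] := eqVneq x 0%R; first by rewrite invr0 mul0r.
have xx : (0 < x * x)%R by rewrite -expr2 exprn_even_gt0.
by rewrite expRN lnK// invfM mulrA divff// mul1r.
Qed.

Lemma measurable_ratio (a b : T -> R) : measurable_fun setT a ->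
  measurable_fun setT b -> measurable_fun setT (fun t => a t / b t)%R.
Proof.
move=> ma mb; apply: measurable_funM => //.
exact: (measurableT_comp measurable_invr).
Qed.

Lemma measurable_log_ratio (a b : T -> R) : measurable_fun setT a ->
  measurable_fun setT b -> measurable_fun setT (fun t => ln (a t / b t)).
Proof.
move=> ma mb; apply: measurableT_comp; first exact: measurable_ln.
exact: measurable_ratio.
Qed.

End measurable_ratio.

Section gibbs.
Context {R : realType}.

(** The integrand of the relative entropy in nats, corrected by [p - q]: for equal finite masses the
    integral does not change, and the integrand becomes nonnegative pointwise. *)
Definition gibbs (p q : R) : R := (p * ln (p / q) - (p - q))%R.

(** For positive [p] and [q], with [s = ln (p / q)], the quantity is [p (exp (- s) - (1 - s))], and
    [exp u >= 1 + u] is strict unless [u = 0]. The last hypothesis excludes [q = 0 < p], where the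
    conventions at 0 would give [- p]. *)
Lemma gibbs_ge0 (p q : R) : (0 <= p)%R -> (0 <= q)%R -> (q = 0 -> p = 0)%R ->
  (0 <= gibbs p q)%R /\ (gibbs p q = 0%R -> p = q).
Proof.
rewrite /gibbs => p0 q0 qp; have [q_0|q_neq0] := eqVneq q 0%R.
  by rewrite (qp q_0) q_0 mul0r !subr0.
have {q0 qp} q_gt0 : (0 < q)%R by rewrite lt_def q_neq0.
have [->|p_neq0] := eqVneq p 0%R.
  by rewrite mul0r !sub0r opprK ltW.
have {p0} p_gt0 : (0 < p)%R by rewrite lt_def p_neq0.
have pq_gt0 : (0 < p / q)%R by rewrite divr_gt0.
have qE : q = (p * expR (- ln (p / q)))%R.
  by rewrite expRN lnK ?posrE// invf_div mulrCA divff// mulr1.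
have -> : (p * ln (p / q) - (p - q) =
    p * (expR (- ln (p / q)) - (1 + - ln (p / q))))%R.
  by rewrite {2}qE; ring.
split.
  by apply: mulr_ge0; [exact: ltW|rewrite subr_ge0 expR_ge1Dx].
move=> /eqP; rewrite mulf_eq0 (negbTE p_neq0)/= subr_eq0 => /eqP expE.
have [/eqP|/expR_gt1Dx] := eqVneq (- ln (p / q))%R 0%R; last first.
  by rewrite expE ltxx.
rewrite oppr_eq0 => /eqP ln0.
by rewrite [RHS]qE ln0 oppr0 expR0 mulr1.
Qed.

Lemma gibbsxx (p : R) : gibbs p p = 0%R.
Proof.
rewrite /gibbs subrr subr0; have [->|p0] := eqVneq p 0%R; first by rewrite mul0r.
by rewrite divff// ln1 mulr0.
Qed.

End gibbs.

Section integral_addition.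
Context d (T : measurableType d) (R : realType) (mu : {measure set T -> \bar R}).

(** Additivity that tolerates an infinite integral of [f], as a divergence may be infinite. In that
    case [f <= (f + g)^+ + |g|] makes the positive part of the sum infinite, while the negative part
    is dominated by [|g|]. *)
Lemma integral_ge0D (f g : T -> R) : measurable_fun setT f ->
  (forall t, (0 <= f t)%R) -> mu.-integrable setT (EFin \o g) ->
  \int[mu]_t (f t + g t)%:E = \int[mu]_t (f t)%:E + \int[mu]_t (g t)%:E.
Proof.
move=> mf f0 ig.
have mg : measurable_fun setT g by apply/measurable_EFinP; exact: measurable_int ig.
have mfE : measurable_fun setT (EFin \o f) by exact/measurable_EFinP.
have mfg : measurable_fun setT (EFin \o (fun t => f t + g t)%R).
  by apply/measurable_EFinP; exact: measurable_funD.
have [ifoo|] := ltP (\int[mu]_t (f t)%:E) +oo.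
  have if_ : mu.-integrable setT (EFin \o f).
    apply/integrableP; split => //.
    by under eq_integral do rewrite /= ger0_norm//.
  by rewrite -integralD_EFin//; apply: eq_integral.
rewrite leye_eq => /eqP foo.
have goo : \int[mu]_t (g t)%:E \is a fin_num by exact: integrable_fin_num ig.
rewrite foo addye; last by move: goo; rewrite fin_numE => /andP[].
set h := fun t => (f t + g t)%:E.
have gabs : \int[mu]_t `|(g t)%:E| < +oo by move/integrableP : ig => [].
have mabs : measurable_fun setT (fun t => `|(g t)%:E|).
  by apply: measurableT_comp => //; exact/measurable_EFinP.
have hn : \int[mu]_t h^\- t < +oo.
  apply: le_lt_trans gabs; apply: ge0_le_integral => //.
  - exact: measurable_funeneg.
  - move=> t _; rewrite funenegE /h /=.
    rewrite ge_max !lee_fin normr_ge0 andbT.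
    have := ler_norm (- g t)%R; rewrite normrN; have := f0 t; lra.
have hp : \int[mu]_t h^\+ t = +oo.
  have : \int[mu]_t (f t)%:E <= \int[mu]_t (h^\+ t + `|(g t)%:E|).
    apply: ge0_le_integral => //.
    - by move=> t _; rewrite lee_fin.
    - apply: emeasurable_funD => //.
      exact: measurable_funepos.
    - move=> t _; rewrite funeposE /h.
      have [h0|h0] := leP 0 (f t + g t)%:E.
        rewrite -EFinD lee_fin.
        by have := ler_norm (- g t)%R; rewrite normrN; lra.
      rewrite add0e lee_fin; move: h0; rewrite lte_fin => h0.
      by have := ler_norm (- g t)%R; rewrite normrN; lra.
  rewrite foo leye_eq ge0_integralD//; last exact: measurable_funepos.
  move=> /eqP hgoo; apply/eqP; rewrite -leye_eq leNgt; apply/negP => hlt.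
  by have := lte_add_pinfty hlt gabs; rewrite hgoo ltxx.
rewrite integralE hp.
have hn0 : 0 <= \int[mu]_t h^\- t by exact: integral_ge0.
have : - (\int[mu]_t h^\- t) \is a fin_num by rewrite fin_numN ge0_fin_numE.
by rewrite fin_numE => /andP[noo _]; rewrite addye.
Qed.

End integral_addition.

Section relative_entropy.
Context d (T : measurableType d) (R : realType) (mu : {measure set T -> \bar R}).
Variables p q : T -> R.
Hypotheses (mp : measurable_fun setT p) (mq : measurable_fun setT q).
Hypotheses (p0 : forall t, (0 <= p t)%R) (q0 : forall t, (0 <= q t)%R).
Hypothesis qp : {ae mu, forall t, q t = 0%R -> p t = 0%R}.

(* The Kullback-Leibler divergence in nats when p and q have the same mass; the
   absolute value only acts on the null set where q vanishes and p does not. *)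
Definition divergence : \bar R := \int[mu]_t `|gibbs (p t) (q t)|%:E.

Lemma divergence_ge0 : 0 <= divergence.
Proof. by apply: integral_ge0 => t _; rewrite lee_fin. Qed.

Lemma measurable_gibbs : measurable_fun setT (fun t => gibbs (p t) (q t)).
Proof.
apply: measurable_funB; last exact: measurable_funB.
by apply: measurable_funM => //; exact: measurable_log_ratio.
Qed.

Lemma divergence_eq0 : divergence = 0 <-> {ae mu, forall t, p t = q t}.
Proof.
have mg : measurable_fun setT (fun t => (gibbs (p t) (q t))%:E).
  by apply/measurable_EFinP; exact: measurable_gibbs.
rewrite /divergence; split.
  move/(ae_eq_integral_abs mu measurableT mg).
  apply: filterS2 qp => t qpt gt0.
  by apply: (gibbs_ge0 (p0 t) (q0 t) qpt).2; have [] := gt0 I.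
move=> pq; apply/(ae_eq_integral_abs mu measurableT mg).
by apply: filterS pq => t -> _; rewrite gibbsxx.
Qed.

(** Common source of the formulas for entropy and for information: almost everywhere [p ln g] is the
    Gibbs integrand plus [(p - q) + p l], and only the first summand may fail to be integrable. *)
Lemma integral_log2 (g l : T -> R) : measurable_fun setT g ->
  mu.-integrable setT (EFin \o p) -> mu.-integrable setT (EFin \o q) ->
  mu.-integrable setT (EFin \o (p \* l)%R) ->
  {ae mu, forall t, (p t * ln (g t) = p t * ln (p t / q t) + p t * l t)%R} ->
  \int[mu]_t (p t * log2 (g t))%:E =
  (divergence + (\int[mu]_t (p t)%:E - \int[mu]_t (q t)%:E +
                 \int[mu]_t (p t * l t)%:E)) * ((ln 2)^-1)%:E.
Proof.
move=> mg ip iq il gE.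
have ln2V : (0 <= (ln 2)^-1 :> R)%R by rewrite invr_ge0 ln_ge0// ler1n.
set G := fun t => `|gibbs (p t) (q t)|%R.
set w := fun t => (p t - q t + p t * l t)%R.
have mG : measurable_fun setT G by apply: measurableT_comp => //; exact: measurable_gibbs.
have iw : mu.-integrable setT (EFin \o w).
  rewrite (_ : _ \o _ = ((EFin \o p) \- (EFin \o q)) \+ (EFin \o (p \* l)%R))//.
  by apply: integrableD => //; exact: integrableB.
have mw : measurable_fun setT w by apply/measurable_EFinP; exact: measurable_int iw.
have iwE : \int[mu]_t (w t)%:E = \int[mu]_t (p t)%:E - \int[mu]_t (q t)%:E +
                 \int[mu]_t (p t * l t)%:E.
  rewrite -integralB_EFin//.
  rewrite -[RHS](@integralD_EFin _ _ _ mu setT _ (fun t => p t - q t)%R)//.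
  rewrite (_ : _ \o _ = ((EFin \o p) \- (EFin \o q)))//.
  exact: integrableB.
rewrite -iwE.
transitivity (\int[mu]_t (G t * (ln 2)^-1 + w t * (ln 2)^-1)%:E).
  apply: ae_eq_integral => //.
  - apply/measurable_EFinP/measurable_funM => //.
    apply: measurable_funM => //.
    by apply: measurableT_comp => //; exact: measurable_ln.
  - by apply/measurable_EFinP/measurable_funD; exact: measurable_funM.
  - apply: filterS2 gE qp => t gt qpt _.
    congr EFin; rewrite /log2 mulrA gt -mulrDl; congr (_ * _)%R.
    rewrite /G /w ger0_norm; last exact: (gibbs_ge0 (p0 t) (q0 t) qpt).1.
    rewrite /gibbs; ring.
have iwl : mu.-integrable setT (EFin \o (fun t => w t * (ln 2)^-1)%R).
  rewrite (_ : _ \o _ = fun t => ((ln 2)^-1)%:E * (EFin \o w) t).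
    exact: integrableZl.
  by apply/funext => t /=; rewrite -EFinM mulrC.
have mGV : measurable_fun setT (fun t => G t * (ln 2)^-1)%R by exact: measurable_funM.
have GV0 t : (0 <= G t * (ln 2)^-1)%R by rewrite mulr_ge0// normr_ge0.
rewrite (integral_ge0D mGV GV0 iwl).
under eq_integral do rewrite EFinM.
rewrite ge0_integralZr ?lee_fin//; last 2 first.
- exact/measurable_EFinP.
- by move=> t _; rewrite lee_fin normr_ge0.
under [X in _ + X]eq_integral do rewrite EFinM.
rewrite (integralZr measurableT iw) [RHS]muleDl//; apply: fin_num_adde_defl.
exact: integrable_fin_num iw.
Qed.

End relative_entropy.

(** * Densities *)

Section pdf.
Context d (T : measurableType d) (R : realType) (P : probability T R).
Context d1 (T1 : measurableType d1).
Variables (mu : {sigma_finite_measure set T1 -> \bar R}) (X : {mfun T >-> T1}).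

(** [density] is controlled only up to a null set. The arguments run on versions that are
    nonnegative and measurable everywhere, and [pdf_density] carries the results back. *)
Definition is_pdf (p : T1 -> R) : Prop :=
  [/\ measurable_fun setT p, forall t, (0 <= p t)%R
    & forall A, measurable A ->
        distribution P X A = \int[mu]_(t in A) (p t)%:E].

Lemma pdf_has_density (p : T1 -> R) : is_pdf p -> has_density P mu X.
Proof.
move=> [mp p0 pE]; apply/null_content_dominatesP => A mA A0.
rewrite pE//; apply: null_set_integral => //.
exact/measurable_EFinP/measurable_funTS.
Qed.

Lemma pdf_integral1 (p : T1 -> R) : is_pdf p -> \int[mu]_t (p t)%:E = 1.
Proof. by move=> [mp p0 pE]; rewrite -pE//; exact: probability_setT. Qed.

Lemma integrable_pdf (p : T1 -> R) :
  is_pdf p -> mu.-integrable setT (EFin \o p).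
Proof.
move=> pdf; have [mp p0 _] := pdf; apply/integrableP; split.
  exact/measurable_EFinP.
under eq_integral do rewrite /= ger0_norm//.
by rewrite (pdf_integral1 pdf) ltry.
Qed.

Lemma pdf_ae_unique (p q : T1 -> R) : is_pdf p -> is_pdf q ->
  {ae mu, forall t, p t = q t}.
Proof.
move=> pdfp [mq _ qE]; have [_ _ pE] := pdfp.
have : ae_eq mu setT (EFin \o p) (EFin \o q).
  apply: integral_ae_eq => //; first exact: integrable_pdf.
    exact/measurable_EFinP.
  by move=> A _ mA; rewrite -pE// -qE.
by apply: filterS => t /(_ I)[].
Qed.

Lemma ae_eq_pdf (p q : T1 -> R) : is_pdf p ->
  measurable_fun setT q -> (forall t, (0 <= q t)%R) ->
  {ae mu, forall t, p t = q t} -> is_pdf q.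
Proof.
move=> [mp p0 pE] mq q0 pq; split => // A mA; rewrite pE//.
apply: ge0_ae_eq_integral => //.
- exact/measurable_EFinP/measurable_funTS.
- exact/measurable_EFinP/measurable_funTS.
- by move=> t _; rewrite lee_fin.
- by move=> t _; rewrite lee_fin.
- by apply: filterS pq => t ->.
Qed.

Lemma measurable_density :
  has_density P mu X -> measurable_fun setT (density P mu X).
Proof.
by move=> XP; rewrite /density; exact: measurableT_comp.
Qed.

Lemma has_density_pdf : has_density P mu X ->
  exists2 p, is_pdf p & {ae mu, forall t, density P mu X t = p t}.
Proof.
move=> XP; pose f := Radon_Nikodym_SigmaFinite.f (distribution P X) mu.
have ffin t : f t \is a fin_num by exact: Radon_Nikodym_SigmaFinite.f_fin_num.
have fE A : measurable A -> distribution P X A = \int[mu]_(x in A) f x.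
  exact: Radon_Nikodym_SigmaFinite.f_integral.
have mf : measurable_fun setT f.
  apply: measurable_int; exact: Radon_Nikodym_SigmaFinite.f_integrable.
exists (fine \o f).
  split.
  - exact: measurableT_comp.
  - by move=> t; apply: fine_ge0; exact: Radon_Nikodym_SigmaFinite.f_ge0.
  - by move=> A mA; rewrite fE//; apply: eq_integral => t _; rewrite fineK.
have := ae_eq_Radon_Nikodym_SigmaFinite XP measurableT.
by apply: filterS => t /(_ I) fRN; rewrite /density /f /= fRN.
Qed.

Lemma pdf_density (p : T1 -> R) : is_pdf p ->
  {ae mu, forall t, density P mu X t = p t}.
Proof.
move=> pdfp; have [q pdfq] := has_density_pdf (pdf_has_density pdfp).
by apply: filterS2 (pdf_ae_unique pdfp pdfq) => t -> ->.
Qed.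

(** After [p] is replaced by the Radon-Nikodym derivative, both sides are the integral of [g]
    against the law of [X]. *)
Lemma pdf_expectation (p g : T1 -> R) : is_pdf p ->
  measurable_fun setT g -> (forall t, (0 <= g t)%R) ->
  \int[mu]_t (p t * g t)%:E = \int[P]_w (g (X w))%:E.
Proof.
move=> pdfp mg g0; have [mp p0 pE] := pdfp.
have XP := pdf_has_density pdfp.
have mgE : measurable_fun setT (EFin \o g) by exact/measurable_EFinP.
pose f := Radon_Nikodym_SigmaFinite.f (distribution P X) mu.
have fE A : measurable A -> distribution P X A = \int[mu]_(x in A) f x.
  exact: Radon_Nikodym_SigmaFinite.f_integral.
have if_ : mu.-integrable setT f by exact: Radon_Nikodym_SigmaFinite.f_integrable.
have f0 : forall t, 0 <= f t by exact: Radon_Nikodym_SigmaFinite.f_ge0.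
transitivity (\int[mu]_t ((g t)%:E * f t)).
  apply: ge0_ae_eq_integral => //.
  - exact/measurable_EFinP/measurable_funM.
  - by apply: emeasurable_funM => //; exact: measurable_int if_.
  - by move=> t _; rewrite lee_fin mulr_ge0.
  - by move=> t _; rewrite mule_ge0// lee_fin.
  - have : ae_eq mu setT f (EFin \o p).
      apply: integral_ae_eq => //; first exact/measurable_EFinP.
      by move=> A _ mA; rewrite -fE// -pE.
    by apply: filterS => t /(_ I) -> _; rewrite EFinM muleC.
rewrite (@Radon_Nikodym_SigmaFinite.change_of_variables _ _ _ _ _ XP (EFin \o g))//.
by rewrite ge0_integral_pushforward//; move=> t _; rewrite /= lee_fin.
Qed.

Lemma pdf_null (p : T1 -> R) (B : set T1) : is_pdf p -> measurable B ->
  distribution P X B = 0 -> {ae mu, forall t, B t -> p t = 0%R}.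
Proof.
move=> [mp p0 pE] mB; rewrite pE// => B0.
have mpB : measurable_fun B (EFin \o p) by exact/measurable_EFinP/measurable_funTS.
have /(ae_eq_integral_abs mu mB mpB) : \int[mu]_(t in B) `|(p t)%:E| = 0.
  by under eq_integral do rewrite /= ger0_norm//.
by apply: filterS => t /[apply] -[].
Qed.

Lemma measurable_zero_set (g : T1 -> R) : measurable_fun setT g ->
  measurable [set t | g t = 0%R].
Proof. by move=> mg; rewrite -[A in measurable A]setTI; exact: (mg _ [set 0%R]). Qed.

Lemma distribution_pdf_eq0 (p : T1 -> R) : is_pdf p ->
  distribution P X [set t | p t = 0%R] = 0.
Proof.
move=> [mp p0 pE].
rewrite pE; last exact: measurable_zero_set.
apply: integral0_eq => t /= ->//.
Qed.

End pdf.

(** * Product densities and marginals *)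

Section product_pdf.
Context d (T : measurableType d) (R : realType) (P : probability T R).
Context d1 d2 (T1 : measurableType d1) (T2 : measurableType d2).
Variables (m1 : {sigma_finite_measure set T1 -> \bar R}).
Variables (m2 : {sigma_finite_measure set T2 -> \bar R}).

Lemma integral_prod_measureM (a : T1 -> R) (b : T2 -> R) :
  measurable_fun setT a -> measurable_fun setT b ->
  (forall t, (0 <= a t)%R) -> (forall t, (0 <= b t)%R) ->
  \int[prod_measure m1 m2]_z (a z.1 * b z.2)%:E =
  \int[m1]_t (a t)%:E * \int[m2]_t (b t)%:E.
Proof.
move=> ma mb a0 b0.
transitivity (\int[m1]_x \int[m2]_y (a x * b y)%:E).
  rewrite -(fubini_tonelli1 (fun z => (a z.1 * b z.2)%:E))//.
    apply/measurable_EFinP/measurable_funM; exact: measurableT_comp.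
  by move=> z; rewrite lee_fin mulr_ge0.
have B0 : 0 <= \int[m2]_t (b t)%:E.
  by apply: integral_ge0 => t _; rewrite lee_fin.
rewrite -ge0_integralZr//; last 2 first.
- exact/measurable_EFinP.
- by move=> t _; rewrite lee_fin.
apply: eq_integral => x _.
under eq_integral do rewrite EFinM.
rewrite ge0_integralZl ?lee_fin//; first exact/measurable_EFinP.
by move=> t _; rewrite lee_fin.
Qed.

Variables (X : {mfun T >-> T1}) (Y : {mfun T >-> T2}).

Lemma measurable_fun_fst_snd (a : T1 -> R) (b : T2 -> R) :
  measurable_fun setT a -> measurable_fun setT b ->
  measurable_fun setT (fun z : T1 * T2 => (a z.1 * b z.2)%R).
Proof. by move=> ma mb; apply: measurable_funM; exact: measurableT_comp. Qed.

(** A null set [A] gives a strip [A x T2] of measure [0 * m2 setT], which is 0 even when [m2] is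
    infinite. *)
Lemma has_density_fst :
  has_density P (prod_measure m1 m2) (rv_pair X Y) -> has_density P m1 X.
Proof.
move=> /null_content_dominatesP XYP; apply/null_content_dominatesP => A mA A0.
have AT0 : prod_measure m1 m2 (A `*` setT) = 0.
  by transitivity (m1 A * m2 setT); [exact: product_measure1E|rewrite A0 mul0e].
rewrite -(XYP _ (measurableX mA measurableT) AT0).
by rewrite /distribution /pushforward; congr (P _); apply/seteqP; split=> w //= [].
Qed.

(** Over a strip [A x T2] the factor [b] integrates to 1. In the equality case this reads off the
    law of the error from the joint density. *)
Lemma pdf_fst (a : T1 -> R) (b : T2 -> R) :
  measurable_fun setT a -> (forall t, (0 <= a t)%R) -> is_pdf P m2 Y b ->
  is_pdf P (prod_measure m1 m2) (rv_pair X Y) (fun z => a z.1 * b z.2)%R ->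
  is_pdf P m1 X a.
Proof.
move=> ma a0 pdfb [_ _ abE]; have [mb b0 _] := pdfb; split => // A mA.
have -> : distribution P X A = distribution P (rv_pair X Y) (A `*` setT).
  by rewrite /distribution /pushforward; congr (P _); apply/seteqP; split=> w //= [].
rewrite abE; last exact: measurableX.
rewrite integral_mkcond [RHS]integral_mkcond.
rewrite -[RHS]mule1 -(pdf_integral1 pdfb).
have patchA (t : T1) : ((EFin \o a) \_ A) t = (a t * \1_A t)%:E.
  by rewrite patchE indicE; case: (t \in A); rewrite /= ?mulr1 ?mulr0.
under [in RHS]eq_integral do rewrite patchA.
rewrite -integral_prod_measureM//; last 2 first.
- exact: measurable_funM.
- by move=> t; rewrite mulr_ge0.
apply: eq_integral => -[t s] _; rewrite patchE indicE/=.
rewrite (_ : (_ \in _) = (t \in A)); last first.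
  by apply/idP/idP; rewrite !inE/= => // -[].
by case: (t \in A); rewrite ?mulr1// mulr0 mul0r.
Qed.

End product_pdf.

(** * Lebesgue measure and the shear *)

Section lebesgue_line_theory.
Context {R : realType}.
Local Notation lambda := (lebesgue_line R).

(** [lebesgue_line] is the image of [lebesgue_measure] under the identity between the two measurable
    structures on [R]. *)
Lemma ge0_integral_lebesgue_line (f : R -> \bar R) :
  measurable_fun setT f -> (forall t, 0 <= f t) ->
  \int[lambda]_t f t = \int[lebesgue_measure]_t f t.
Proof.
move=> mf f0.
have mid : measurable_fun setT (idfun : measurableTypeR R -> R) by exact: measurable_id.
exact: (@ge0_integral_pushforward _ _ (measurableTypeR R) R R idfun mid lebesgue_measure setT f).
Qed.

Lemma lebesgue_line_itvcc (a b : R) : (a <= b)%R -> lambda `[a, b]%classic = (b - a)%:E.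
Proof.
move=> ab; transitivity (lebesgue_measure `[a, b]%classic) => //.
rewrite lebesgue_measure_itv/= lte_fin; case: ltP => [_|ba]; first by rewrite EFinB.
by rewrite (@le_anti _ _ a b) ?ab// subrr.
Qed.

Lemma lebesgue_line_set1 (a : R) : lambda [set a] = 0.
Proof. exact: (@lebesgue_measure_set1 R a). Qed.

(** The image measure gives half-open intervals their length, which characterises Lebesgue
    measure. *)
Lemma lebesgue_line_translation (s : R) (A : set R) : measurable A ->
  lambda ((fun t => t - s)%R @^-1` A) = lambda A.
Proof.
move=> mA.
have mphi : measurable_fun setT ((fun t => t - s)%R : measurableTypeR R -> measurableTypeR R).
  exact: measurable_funB.
pose m := measure_function_pushforward__canonical__measure_function_Measure
  (@lebesgue_measure R) mphi.
apply/esym/(@lebesgue_measure_unique _ m) => // _ [[a b]] _ <-.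
rewrite /m /= /pushforward.
have -> : (fun t => t - s)%R @^-1` [set` `]a, b]] = `](a + s)%R, (b + s)%R]%classic.
  by apply/seteqP; split => t /=; rewrite !in_itv/= ltrBrDr lerBlDr.
rewrite /= !lebesgue_measure_itv/= !lte_fin ltrD2r; case: ifP => // _.
by rewrite -!EFinD; congr EFin; ring.
Qed.

Lemma lebesgue_line_reflection (s : R) (A : set R) : measurable A ->
  lambda ((fun t => s - t)%R @^-1` A) = lambda A.
Proof.
move=> mA; have mopp : measurable_fun setT (-%R : R -> R) by exact: measurable_funN.
have mA' : measurable ((fun t => t - s)%R @^-1` (-%R @^-1` A)).
  by rewrite -[X in measurable X]setTI; apply: measurable_funB => //;
     rewrite -[X in measurable X]setTI; exact: mopp.
have -> : (fun t => s - t)%R @^-1` A = (fun t => t - s)%R @^-1` (-%R @^-1` A).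
  by apply/seteqP; split => t /=; rewrite opprB.
rewrite lebesgue_line_translation; first exact: lebesgue_measureN.
by rewrite -[X in measurable X]setTI; exact: mopp.
Qed.

Lemma ge0_integral_translation (s : R) (f : R -> \bar R) :
  measurable_fun setT f -> (forall t, 0 <= f t) ->
  \int[lambda]_t f (t - s)%R = \int[lambda]_t f t.
Proof.
move=> mf f0.
have mphi : measurable_fun setT ((fun t => t - s)%R : R -> R) by exact: measurable_funB.
rewrite -(@ge0_integral_pushforward _ _ _ _ _ _ mphi lambda setT f)//.
by apply: eq_measure_integral => A mA _; exact: lebesgue_line_translation.
Qed.

Lemma ge0_integral_reflection (s : R) (f : R -> \bar R) :
  measurable_fun setT f -> (forall t, 0 <= f t) ->
  \int[lambda]_t f (s - t)%R = \int[lambda]_t f t.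
Proof.
move=> mf f0.
have mphi : measurable_fun setT ((fun t => s - t)%R : R -> R) by exact: measurable_funB.
rewrite -(@ge0_integral_pushforward _ _ _ _ _ _ mphi lambda setT f)//.
by apply: eq_measure_integral => A mA _; exact: lebesgue_line_reflection.
Qed.

End lebesgue_line_theory.

Section almost_everywhere_product.
Context d1 d2 (T1 : measurableType d1) (T2 : measurableType d2) (R : realType).
Variables (m1 : {sigma_finite_measure set T1 -> \bar R}).
Variables (m2 : {sigma_finite_measure set T2 -> \bar R}).

Lemma ae_fst (Q : T1 -> Prop) : {ae m1, forall t, Q t} ->
  {ae prod_measure m1 m2, forall z, Q z.1}.
Proof.
move=> [N [mN N0 QN]]; exists (N `*` setT); split.
- exact: measurableX.
- by transitivity (m1 N * m2 setT); [exact: product_measure1E|rewrite N0 mul0e].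
- by move=> z nQz; split => //; exact: QN.
Qed.

Lemma ae_snd (Q : T2 -> Prop) : {ae m2, forall t, Q t} ->
  {ae prod_measure m1 m2, forall z, Q z.2}.
Proof.
move=> [N [mN N0 QN]]; exists (setT `*` N); split.
- exact: measurableX.
- by transitivity (m1 setT * m2 N); [exact: product_measure1E|rewrite N0 mule0].
- by move=> z nQz; split => //; exact: QN.
Qed.

(** Both sides agree on rectangles. This moves the newest coordinate, the second factor in
    [lebesgue_rcons], to the first place. *)
Lemma prod_measure_swap (A : set (T1 * T2)) : measurable A ->
  prod_measure m2 m1 (unstable.swap @^-1` A) = prod_measure m1 m2 A.
Proof.
move=> mA.
have mswap : measurable_fun setT (@unstable.swap T2 T1) by exact: measurable_swap.
pose m := measure_function_pushforward__canonical__measure_function_Measure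
  (prod_measure m2 m1) mswap.
apply/esym/(@product_measure_unique _ _ _ _ _ _ _ m) => // B C mB mC.
rewrite /m /= /pushforward.
have -> : unstable.swap @^-1` (B `*` C) = C `*` B by apply/seteqP; split => -[? ?] [].
by rewrite muleC; exact: product_measure1E.
Qed.

End almost_everywhere_product.

Section shear.
Context d2 (T2 : measurableType d2) (R : realType).
Variables (mu : {sigma_finite_measure set T2 -> \bar R}) (f : {mfun T2 >-> R}).
Local Notation M := (prod_measure (lebesgue_line R) mu).

Definition shear (z : R * T2) : R * T2 := ((z.1 - f z.2)%R, z.2).
Definition unshear (z : R * T2) : R * T2 := ((z.1 + f z.2)%R, z.2).

Lemma shearK : cancel shear unshear.
Proof. by move=> [x y]; rewrite /shear /unshear /= subrK. Qed.

Lemma measurable_shear : measurable_fun setT shear.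
Proof.
apply: measurable_fun_pair => //.
by apply: measurable_funB => //; exact: measurableT_comp.
Qed.

Lemma measurable_unshear : measurable_fun setT unshear.
Proof.
apply: measurable_fun_pair => //.
by apply: measurable_funD => //; exact: measurableT_comp.
Qed.

(** Tonelli lets the real variable be integrated first; for fixed [y] the shear is the translation
    by [f y]. *)
Lemma ge0_integral_shear (F : R * T2 -> \bar R) :
  measurable_fun setT F -> (forall z, 0 <= F z) ->
  \int[M]_z F (shear z) = \int[M]_z F z.
Proof.
move=> mF F0.
transitivity (\int[mu]_y \int[lebesgue_line R]_x F (shear (x, y))).
  rewrite -(fubini_tonelli2 (fun z => F (shear z)))//.
  exact: (measurableT_comp mF measurable_shear).
transitivity (\int[mu]_y \int[lebesgue_line R]_x F (x, y)).
  apply: eq_integral => y _.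
  rewrite (ge0_integral_translation (f y) (f := fun x => F (x, y)))//.
  exact: measurableT_comp.
by rewrite -(fubini_tonelli2 F).
Qed.

Lemma integral_shear (F : R * T2 -> \bar R) : measurable_fun setT F ->
  \int[M]_z F (shear z) = \int[M]_z F z.
Proof.
move=> mF; rewrite integralE [RHS]integralE; congr (_ - _).
  rewrite -(ge0_integral_shear (measurable_funepos mF) (funepos_ge0 F)).
  by apply: eq_integral => z _; rewrite !funeposE.
rewrite -(ge0_integral_shear (measurable_funeneg mF) (funeneg_ge0 F)).
by apply: eq_integral => z _; rewrite !funenegE.
Qed.

End shear.

Section sheared_density.
Context d (T : measurableType d) (R : realType) (P : probability T R).
Context d2 (T2 : measurableType d2).
Variables (mu : {sigma_finite_measure set T2 -> \bar R}) (f : {mfun T2 >-> R}).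
Variables (X E : {mfun T >-> R}) (Y : {mfun T >-> T2}).
Hypothesis EXY : forall w, E w = (X w - f (Y w))%R.
Local Notation M := (prod_measure (lebesgue_line R) mu).

(** An event for [(E, Y)] is the event for [(X, Y)] pulled back by the shear. As the shear preserves
    the measure, no Jacobian factor appears. *)
Lemma pdf_shear (p : R * T2 -> R) : is_pdf P M (rv_pair X Y) p ->
  is_pdf P M (rv_pair E Y) (p \o unshear f).
Proof.
move=> [mp p0 pE]; split.
- exact: (measurableT_comp mp (measurable_unshear f)).
- by move=> z; exact: p0.
move=> A mA.
have mSA : measurable (shear f @^-1` A).
  by rewrite -[X in measurable X]setTI; exact: measurable_shear.
have -> : distribution P (rv_pair E Y) A = distribution P (rv_pair X Y) (shear f @^-1` A).
  rewrite /distribution /pushforward; congr (P _); apply/seteqP.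
  by split => w /=; rewrite /shear /rv_pair /= EXY.
rewrite pE// integral_mkcond [RHS]integral_mkcond.
set F := (fun z => ((p \o unshear f) z)%:E) \_ A.
have mF : measurable_fun setT F.
  apply/(measurable_restrictT _ mA)/measurable_EFinP/measurable_funTS.
  exact: (measurableT_comp mp (measurable_unshear f)).
have F0 z : 0 <= F z by rewrite /F patchE; case: ifP => // _; rewrite lee_fin; exact: p0.
rewrite -(ge0_integral_shear mu f mF F0).
apply: eq_integral => z _; by rewrite /F !patchE /= shearK.
Qed.

Lemma cond_diff_entropy_pdf (V : {mfun T >-> R}) (p : R * T2 -> R) (b : T2 -> R) :
  is_pdf P M (rv_pair V Y) p -> is_pdf P mu Y b ->
  cond_diff_entropy P (lebesgue_line R) mu V Y =
  - \int[M]_z (p z * log2 (p z / b z.2))%:E.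
Proof.
move=> pdfp pdfb; rewrite /cond_diff_entropy; congr (- _).
have [mp p0 _] := pdfp; have [mb b0 _] := pdfb.
have mf := measurable_density (pdf_has_density pdfp).
have mg := measurable_density (pdf_has_density pdfb).
have mlog (u : R * T2 -> R) (v : T2 -> R) : measurable_fun setT u ->
    measurable_fun setT v ->
    measurable_fun setT (fun z => (u z * log2 (u z / v z.2))%:E).
  move=> mu_ mv; apply/measurable_EFinP/measurable_funM => //.
  apply: measurable_funM => //; apply: measurable_log_ratio => //.
  exact: measurableT_comp.
apply: ae_eq_integral => //; [exact: mlog|exact: mlog|].
have := ae_snd (lebesgue_line R) (pdf_density pdfb).
by apply: filterS2 (pdf_density pdfp) => z -> ->.
Qed.

(** Substituting [shear] turns the density of [(E, Y)] into that of [(X, Y)] and fixes the second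
    coordinate, hence also the factor [b]. *)
Lemma cond_diff_entropy_shear :
  has_density P M (rv_pair X Y) -> has_density P mu Y ->
  cond_diff_entropy P (lebesgue_line R) mu X Y =
  cond_diff_entropy P (lebesgue_line R) mu E Y.
Proof.
move=> /has_density_pdf[p pdfp _] /has_density_pdf[b pdfb _].
have pdfE := pdf_shear pdfp.
rewrite (cond_diff_entropy_pdf pdfp pdfb) (cond_diff_entropy_pdf pdfE pdfb).
have [mp _ _] := pdfE; have [mb _ _] := pdfb.
have mF : measurable_fun setT (fun z => ((p \o unshear f) z *
    log2 ((p \o unshear f) z / b z.2))%:E).
  apply/measurable_EFinP/measurable_funM => //.
  apply: measurable_funM => //; apply: measurable_log_ratio => //.
  exact: measurableT_comp.
rewrite -[in RHS](integral_shear mu f mF).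
by congr (- _); apply: eq_integral => z _; rewrite /= shearK.
Qed.

End sheared_density.

(** * Joint law of the present value and the past *)

Section past_density.
Context d (T : measurableType d) (R : realType) (P : probability T R).
Variables (x : nat -> {mfun T >-> R}) (k : nat).

(** Inverse of [rcons_pair] up to the order of the factors: the last entry comes first, to match
    [rv_pair (x k) (past x k)]. *)
Definition unrcons_pair (t : k.+1.-tuple R) : R * k.-tuple R :=
  (tnth t ord_max, [tuple tnth t (widen_ord (leqnSn k) i) | i < k]).

Lemma measurable_unrcons_pair : measurable_fun setT unrcons_pair.
Proof.
apply: measurable_fun_pair; first exact: measurable_tnth.
apply/measurable_fun_tnthP => i.
rewrite (_ : _ \o _ = fun t => tnth t (widen_ord (leqnSn k) i)).
  exact: measurable_tnth.
by apply/funext => t /=; rewrite tnth_mktuple.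
Qed.

Lemma rcons_pairK (z : k.-tuple R * R) : unrcons_pair (rcons_pair z) = unstable.swap z.
Proof.
case: z => t r; rewrite /unrcons_pair /unstable.swap /=; congr (_, _).
  by rewrite (tnth_nth 0%R) /= nth_rcons size_tuple ltnn eqxx.
apply: eq_from_tnth => i; rewrite tnth_mktuple !(tnth_nth 0%R) /=.
by rewrite nth_rcons size_tuple ltn_ord.
Qed.

Lemma unrcons_pair_past (w : T) : unrcons_pair (past x k.+1 w) = (x k w, past x k w).
Proof.
rewrite /unrcons_pair; congr (_, _); first by rewrite tnth_mktuple.
by apply: eq_from_tnth => i; rewrite !tnth_mktuple.
Qed.

(** A null set of [R x R^k] pulls back along [unrcons_pair] to a null set of [R^k.+1], and the last
    entry of [past x k.+1] is [x k]. *)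
Lemma has_density_next :
  has_density P (lebesgue_tuple R k.+1) (past x k.+1) ->
  has_density P (prod_measure (lebesgue_line R) (lebesgue_tuple R k))
    (rv_pair (x k) (past x k)).
Proof.
move=> /null_content_dominatesP dom; apply/null_content_dominatesP => A mA A0.
have mB : measurable (unrcons_pair @^-1` A).
  by rewrite -[X in measurable X]setTI; exact: measurable_unrcons_pair.
have B0 : lebesgue_tuple R k.+1 (unrcons_pair @^-1` A) = 0.
  rewrite -A0; transitivity (prod_measure (lebesgue_tuple R k) (lebesgue_line R)
    (unstable.swap @^-1` A)); last exact: prod_measure_swap.
  rewrite /= /lebesgue_rcons /pushforward; congr (prod_measure _ _ _).
  by apply/seteqP; split => z /=; rewrite rcons_pairK.
rewrite -(dom _ mB B0) /distribution /pushforward; congr (P _).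
by apply/seteqP; split => w /=; rewrite unrcons_pair_past.
Qed.

End past_density.

(** * Supports and uniform laws *)

Section support.
Context d (T : measurableType d) (R : realType) (P : probability T R).
Variable X : {mfun T >-> R}.
Local Notation mu := (distribution P X).

Lemma open_itv_subset (U : set R) (t : R) : open U -> U t ->
  exists2 e : R, (0 < e)%R & `[(t - e)%R, (t + e)%R]%classic `<=` U.
Proof.
move=> oU Ut; have /nbhs_ballP[e /= e0 eU] := open_nbhs_nbhs (conj oU Ut).
exists (e / 2)%R; first by rewrite divr_gt0.
move=> s; rewrite /= in_itv/= => /andP[ts st]; apply: eU.
rewrite /ball/= ltr_norml; lra.
Qed.

(** Each point off the support has a neighbourhood of probability 0, hence lies in an open interval
    with rational ends of probability 0; there are countably many of these. *)
Lemma negligible_setC_support : mu.-negligible (~` rv_support P X).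
Proof.
(* [F] enumerates the null rational intervals; every other code yields the empty set. *)
pose F n := if unpickle n is Some (a, b) then
  if mu `](ratr a : R), (ratr b : R)[%classic == 0
  then `](ratr a : R), (ratr b : R)[%classic else set0 else set0.
apply: (@negligibleS _ _ _ _ (\bigcup_n F n)); last first.
  apply: negligible_bigcup => n; rewrite /F.
  case: (unpickle n) => [[a b]|]; last exact: negligible_set0.
  case: ifPn => [/eqP ab0|_]; last exact: negligible_set0.
  exact/negligibleP.
move=> t /= /existsNP[U] /not_implyP[oU] /not_implyP[Ut] /negP.
rewrite -leNgt => U0.
have [e e0 eU] := open_itv_subset oU Ut.
have [a] : exists a : rat, ratr a \in `](t - e)%R, t[.
  by apply: rat_in_itvoo; rewrite ltrBlDr ltrDl.
rewrite in_itv/= => /andP[ea at_].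
have [b] : exists b : rat, ratr b \in `]t, (t + e)%R[.
  by apply: rat_in_itvoo; rewrite ltrDl.
rewrite in_itv/= => /andP[tb be].
exists (pickle (a, b)); first exact: I.
rewrite /F pickleK.
suff -> : mu `](ratr a : R), (ratr b : R)[%classic = 0.
  by rewrite eqxx /= in_itv/= at_.
apply/eqP; rewrite -measure_le0; apply: le_trans U0.
apply: le_measure; rewrite ?inE//; first exact: open_measurable.
by move=> s /=; rewrite in_itv/= => /andP[as_ sb]; apply: eU; rewrite /= in_itv/=; lra.
Qed.

Lemma distribution_disjoint_support (A : set R) : measurable A ->
  A `<=` ~` rv_support P X -> mu A = 0.
Proof.
move=> mA AX; apply/negligibleP => //.
exact: negligibleS negligible_setC_support.
Qed.

Lemma support_nonempty : rv_support P X !=set0.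
Proof.
apply/set0P/negP => /eqP X0.
have := @distribution_disjoint_support setT measurableT.
by rewrite X0 setC0 probability_setT => /(_ (fun _ => id)) /eqP; rewrite onee_eq0.
Qed.

(** Rests on the support being nonempty: over the empty set the supremum would be [-oo]. *)
Lemma max_deviation_ge0 : 0 <= max_deviation P X.
Proof.
have [t tX] := support_nonempty; apply: (@le_trans _ _ `|t|%:E).
  by rewrite lee_fin.
by apply: ereal_sup_ubound; exists t.
Qed.

Lemma distribution_gt_max_deviation (D : R) : max_deviation P X = D%:E ->
  mu [set t | (D < `|t|)%R] = 0.
Proof.
move=> XD; apply: distribution_disjoint_support.
  have -> : [set t | (D < `|t|)%R] = (fun t : R => `|t|%R) @^-1` `]D, +oo[%classic.
    by apply/seteqP; split => t /=; rewrite in_itv/= andbT.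
  by rewrite -[A in measurable A]setTI; exact: normr_measurable.
move=> t /= Dt tX; have : `|t|%:E <= max_deviation P X.
  by apply: ereal_sup_ubound; exists t.
by rewrite XD lee_fin leNgt Dt.
Qed.

(** A maximum deviation 0 would concentrate [X] on the Lebesgue null set [{0}]. *)
Lemma max_deviation_gt0 : has_density P (lebesgue_line R) X -> 0 < max_deviation P X.
Proof.
move=> /null_content_dominatesP Xac; rewrite lt_def max_deviation_ge0 andbT.
apply/eqP => X0; have := distribution_gt_max_deviation X0.
have -> : [set t : R | (0 < `|t|)%R] = ~` [set 0%R].
  by apply/seteqP; split => t /=; rewrite normr_gt0 => /eqP.
have X00 : distribution P X [set 0%R] = 0.
  by apply: Xac => //; exact: lebesgue_line_set1.
by rewrite probability_setC// [X in _ - X]X00 sube0 => /eqP; rewrite onee_eq0.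
Qed.

End support.

Section uniform.
Context {R : realType}.
Variables a b : R.
Hypothesis ab : (a < b)%R.
Local Notation lambda := (lebesgue_line R).
Local Notation u := (uniform_pdf a b).

Lemma integral_uniform_pdf_line (A : set R) : measurable A ->
  \int[lambda]_(t in A) (u t)%:E = ((b - a)^-1)%:E * lambda (A `&` `[a, b]%classic).
Proof.
move=> mA; rewrite integral_mkcond.
have mI : measurable (A `&` `[a, b]%classic) by exact: measurableI.
rewrite -(setIT (A `&` _)) -integral_indic//.
rewrite -ge0_integralZl;
  [|by []|exact/measurable_EFinP|by move=> t _; rewrite lee_fin
   |by rewrite lee_fin invr_ge0 subr_ge0 ltW].
apply: eq_integral => t _; rewrite patchE indicE in_setI /uniform_pdf.
have -> : (t \in `[a, b]%classic) = (a <= t <= b)%R.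
  by apply/idP/idP; rewrite inE/= in_itv.
by case: (t \in A); case: (a <= t <= b)%R; rewrite /= ?mule1 ?mule0.
Qed.

Lemma integral_uniform_pdf_line1 : \int[lambda]_t (u t)%:E = 1.
Proof.
rewrite integral_uniform_pdf_line// setTI lebesgue_line_itvcc ?ltW//.
by rewrite -EFinM mulVf// subr_eq0 gt_eqF.
Qed.

Context d (T : measurableType d) (P : probability T R) (X : {mfun T >-> R}).

Lemma pdf_uniform_support : is_pdf P lambda X u -> rv_support P X = `[a, b]%classic.
Proof.
move=> [_ _ uE]; apply/seteqP; split => t.
  move=> tX; apply: contrapT => tab.
  have := tX (~` `[a, b]%classic); rewrite uE; last exact: measurableC.
  rewrite integral_uniform_pdf_line; last exact: measurableC.
  rewrite setICl measure0 mule0 ltxx => tX0.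
  suff : false by [].
  by apply: tX0 tab; apply: closed_openC; exact: itv_closed.
rewrite /= in_itv/= => /andP[at_ tb] U oU Ut.
have [e e0 eU] := open_itv_subset oU Ut.
(* [[l, r]] is the intersection of [[a, b]] and [[t - e, t + e]]; it has positive length even when
   [t] is an endpoint. *)
pose l := Num.max a (t - e)%R; pose r := Num.min b (t + e)%R.
have lr : (l < r)%R by rewrite /l /r lt_min !gt_max; apply/andP; split; apply/andP; split => //; lra.
have mU := open_measurable oU.
rewrite uE// integral_uniform_pdf_line//.
apply: mule_gt0; first by rewrite lte_fin invr_gt0 subr_gt0.
apply: (@lt_le_trans _ _ (lambda `[l, r]%classic)).
  by rewrite lebesgue_line_itvcc ?lte_fin ?subr_gt0// ltW.
apply: le_measure; rewrite ?inE//; first exact: measurableI.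
move=> s; rewrite /= in_itv/= ge_max le_min => /andP[/andP[as_ es] /andP[sb se]].
by split; [apply: eU|]; rewrite /= in_itv/=; apply/andP.
Qed.

Lemma pdf_uniform_rv : is_pdf P lambda X u -> uniform_rv P X.
Proof.
move=> Xu; have [_ _ uE] := Xu; rewrite /uniform_rv (pdf_uniform_support Xu).
have lE : lambda `[a, b]%classic = (b - a)%:E by rewrite lebesgue_line_itvcc// ltW.
split.
- exact: segment_compact.
- exact: interval_is_interval.
- by rewrite lE lte_fin subr_gt0 ab ltry.
- move=> A mA; rewrite uE// integral_uniform_pdf_line// lE muleAC -EFinM.
  by rewrite mulVf ?mul1e// subr_eq0 gt_eqF.
Qed.

End uniform.

Section uniform_converse.
Context d (T : measurableType d) (R : realType) (P : probability T R).
Variable X : {mfun T >-> R}.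
Local Notation lambda := (lebesgue_line R).

Lemma uniform_rv_pdf : uniform_rv P X ->
  exists a b : R, [/\ (a < b)%R, rv_support P X = `[a, b]%classic &
    is_pdf P lambda X (uniform_pdf a b)].
Proof.
move=> [cX iX lX XE].
have nX := support_nonempty P X.
have cid (A : set R) : {within A, continuous (@idfun R)}.
  by apply: continuous_subspaceT => t; exact: cvg_id.
have cN (A : set R) : {within A, continuous (-%R : R -> R)}.
  by apply: continuous_subspaceT => t; exact: oppr_continuous.
have [b /set_mem bX bmax] := compact_EVT_max nX cX (cid _).
(* The minimum [a] of the support is found as the point that maximises the negation. *)
have [a /set_mem aX amin] := compact_EVT_max nX cX (cN _).
have SE : rv_support P X = `[a, b]%classic.
  apply/seteqP; split => t.
    move=> /mem_set tX; rewrite /= in_itv/= bmax// andbT.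
    by have := amin _ tX; rewrite lerN2.
  by rewrite /= in_itv/=; exact: iX.
have ab : (a < b)%R.
  move: lX; rewrite SE => /andP[+ _]; rewrite lebesgue_line_itvcc; last first.
    by have /set_mem := mem_set aX; rewrite {1}SE /= in_itv/= => /andP[].
  by rewrite lte_fin subr_gt0.
exists a, b; split => //; split.
- exact: measurable_uniform_pdf.
- by move=> t; exact: uniform_pdf_ge0.
- move=> A mA; rewrite integral_uniform_pdf_line//.
  have := XE A mA; rewrite SE lebesgue_line_itvcc ?ltW// => <-.
  by rewrite muleCA -EFinM mulVf ?mule1// subr_eq0 gt_eqF.
Qed.

Lemma symmetric_max_deviation (c : R) : (0 <= c)%R ->
  rv_support P X = `[- c, c]%classic%R -> max_deviation P X = c%:E.
Proof.
move=> c0 XE; apply/eqP; rewrite eq_le; apply/andP; split.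
  apply: ge_ereal_sup => _ [t + <-]; rewrite XE/= in_itv/= => tc.
  by rewrite lee_fin ler_norml.
apply: ereal_sup_ubound; exists c; last by rewrite ger0_norm.
by rewrite XE/= in_itv/= lexx andbT; lra.
Qed.

(** Since [a <= X <= b] almost surely and the mean is 0, the expectations of [|X - a|] and [|b - X|]
    are [- a] and [b]. The reflection [t |-> a + b - t] preserves the uniform density and exchanges
    the two integrands. *)
Lemma pdf_uniform_mean (a b : R) : (a < b)%R -> zero_mean P X ->
  is_pdf P lambda X (uniform_pdf a b) -> b = (- a)%R.
Proof.
move=> ab [iX X0] Xu; rewrite unlock in X0.
have [mu _ uE] := Xu.
have Xab : {ae P, forall w, (a <= X w <= b)%R}.
  have N0 : distribution P X (~` `[a, b]%classic) = 0.
    rewrite uE; last exact: measurableC.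
    by rewrite integral_uniform_pdf_line// ?setICl ?measure0 ?mule0//; exact: measurableC.
  exists (X @^-1` ~` `[a, b]%classic); split => //.
    by rewrite -[A in measurable A]setTI; apply: measurable_funPT => //; exact: measurableC.
have icst r : P.-integrable setT (EFin \o cst r) by exact: finite_measure_integrable_cst.
have Ecst (r : R) : \int[P]_w (cst r w)%:E = r%:E.
  transitivity (\int[P]_w cst r%:E w) => //.
  by rewrite integral_cst// [X in _ * X]probability_setT mule1.
have mX : measurable_fun setT X by exact: measurable_funPT.
have Ea : \int[P]_w `|X w - a|%:E = (- a)%:E.
  transitivity (\int[P]_w ((X w)%:E - (cst a w)%:E)).
    apply: ae_eq_integral => //.
    - by apply/measurable_EFinP; apply: measurableT_comp => //; exact: measurable_funB.
    - by apply/measurable_EFinP; exact: measurable_funB.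
    - by apply: filterS Xab => w /andP[aw _] _; rewrite ger0_norm ?subr_ge0.
  by rewrite integralB_EFin// X0 Ecst sub0e.
have Eb : \int[P]_w `|b - X w|%:E = b%:E.
  transitivity (\int[P]_w ((cst b w)%:E - (X w)%:E)).
    apply: ae_eq_integral => //.
    - by apply/measurable_EFinP; apply: measurableT_comp => //; exact: measurable_funB.
    - by apply/measurable_EFinP; exact: measurable_funB.
    - by apply: filterS Xab => w /andP[_ wb] _; rewrite ger0_norm ?subr_ge0.
  by rewrite integralB_EFin// X0 Ecst sube0.
suff : \int[P]_w `|b - X w|%:E = \int[P]_w `|X w - a|%:E.
  by rewrite Ea Eb => /eqP; rewrite eqe => /eqP.
have mb : measurable_fun setT (fun t : R => `|b - t|%R).
  by apply: measurableT_comp => //; exact: measurable_funB.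
have ma : measurable_fun setT (fun t : R => `|t - a|%R).
  by apply: measurableT_comp => //; exact: measurable_funB.
rewrite -(pdf_expectation Xu mb)// -(pdf_expectation Xu ma)//.
rewrite -[RHS](ge0_integral_reflection (a + b)%R).
- apply: eq_integral => t _.
  have -> : (b - t = a + b - t - a)%R by ring.
  congr (_ * _)%:E; rewrite /uniform_pdf; congr (if _ then _ else _).
  by apply/idP/idP => /andP[? ?]; apply/andP; split; lra.
- by apply/measurable_EFinP; exact: measurable_funM.
- by move=> t; rewrite lee_fin mulr_ge0// uniform_pdf_ge0.
Qed.

End uniform_converse.

(** * The reference weight for unbounded errors *)

Section two_sided_exponential.
Context {R : realType}.

(** By symmetry the integral is twice that over the half-line, which the exponential law of mass 1
    bounds. *)
Lemma integral_expR_Nabs : \int[lebesgue_line R]_t (expR (- `|t|))%:E < +oo.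
Proof.
have cont : continuous (fun t : R => expR (- `|t|)).
  move=> t; apply: (@continuous_comp R R R (fun t => - `|t|)%R (@expR R)).
    apply: (@continuous_comp R R R (fun t => `|t|)%R (fun t => - t)%R).
      exact: norm_continuous.
    exact: oppr_continuous.
  exact: continuous_expR.
rewrite ge0_integral_lebesgue_line; last 2 first.
- by apply/measurable_EFinP; exact: continuous_measurable_fun.
- by move=> t; rewrite lee_fin expR_ge0.
rewrite ge0_symfun_integralT;
  [|by move=> t; exact: expR_ge0|by []|by move=> t; rewrite /= normrN].
apply: lte_mul_pinfty => //.
apply: (@le_lt_trans _ _ (\int[lebesgue_measure]_t (exponential_pdf (1:R) t)%:E)); last first.
  by rewrite integral_exponential_pdf// ltry.
have mpos : measurable [set t : R | (0 <= t)%R] by rewrite -set_itvcy.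
have mexp : measurable_fun setT (EFin \o exponential_pdf (1:R)).
  by apply/measurable_EFinP; exact: measurable_exponential_pdf.
apply: (@le_trans _ _ (\int[lebesgue_measure]_(t in [set t : R | (0 <= t)%R]) (exponential_pdf (1:R) t)%:E)).
  rewrite le_eqVlt; apply/orP; left; apply/eqP; apply: eq_integral => t.
  by rewrite inE/= => t0; rewrite exponential_pdfE// ger0_norm// mulN1r mul1r.
apply: ge0_subset_integral => // t _.
by rewrite lee_fin exponential_pdf_ge0.
Qed.

End two_sided_exponential.

(** * Entropy and information as divergences *)

Section information_divergence.
Context d (T : measurableType d) (R : realType) (P : probability T R).
Context d2 (T2 : measurableType d2) (mu : {sigma_finite_measure set T2 -> \bar R}).
Variables (X : {mfun T >-> R}) (Y : {mfun T >-> T2}).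
Variables (p : R * T2 -> R) (b : T2 -> R).
Local Notation lambda := (lebesgue_line R).
Local Notation M := (prod_measure lambda mu).
Hypothesis pdfp : is_pdf P M (rv_pair X Y) p.
Hypothesis pdfb : is_pdf P mu Y b.

Let mp : measurable_fun setT p. Proof. by have [] := pdfp. Qed.
Let p0 z : (0 <= p z)%R. Proof. by have [] := pdfp. Qed.
Let mb : measurable_fun setT b. Proof. by have [] := pdfb. Qed.
Let b0 y : (0 <= b y)%R. Proof. by have [] := pdfb. Qed.

Lemma pdf_pair_null_fst (A : set R) : measurable A -> distribution P X A = 0 ->
  {ae M, forall z, A z.1 -> p z = 0%R}.
Proof.
move=> mA A0; have := pdf_null pdfp (measurableX mA (@measurableT _ T2)).
have -> : distribution P (rv_pair X Y) (A `*` setT) = distribution P X A.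
  by rewrite /distribution /pushforward; congr (P _); apply/seteqP; split=> w //= [].
move=> /(_ A0); apply: filterS => z pz Az; exact: pz.
Qed.

(** Holds because [b (Y)] vanishes with probability 0. Together with [pdf_pair_null_fst] it shows
    that [p] vanishes wherever a product reference does. *)
Lemma pdf_pair_null_snd : {ae M, forall z, b z.2 = 0%R -> p z = 0%R}.
Proof.
have mB : measurable [set y | b y = 0%R] by exact: measurable_zero_set.
have := pdf_null pdfp (measurableX (@measurableT _ R) mB).
have -> : distribution P (rv_pair X Y) (setT `*` [set y | b y = 0%R]) =
    distribution P Y [set y | b y = 0%R].
  by rewrite /distribution /pushforward; congr (P _); apply/seteqP; split=> w //= [].
move=> /(_ (distribution_pdf_eq0 pdfb)); apply: filterS => z pz bz; exact: pz.
Qed.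

Lemma integrable_pdf_prod (c : R -> R) (C : R) : measurable_fun setT c ->
  (forall t, (0 <= c t)%R) -> \int[lambda]_t (c t)%:E = C%:E ->
  \int[M]_z (c z.1 * b z.2)%:E = C%:E /\
  M.-integrable setT (EFin \o (fun z => c z.1 * b z.2)%R).
Proof.
move=> mc c0 cC.
have qC : \int[M]_z (c z.1 * b z.2)%:E = C%:E.
  by rewrite integral_prod_measureM// (pdf_integral1 pdfb) cC mule1.
split=> //; apply/integrableP; split.
  by apply/measurable_EFinP; exact: measurable_fun_fst_snd.
under eq_integral do rewrite /= ger0_norm ?mulr_ge0//.
by rewrite qC ltry.
Qed.

(* The reference density c need not be normalised, and l is its logarithm where
   X lives, so l may be chosen without singularities. *)
Lemma cond_diff_entropy_divergence (c l : R -> R) (C : R) :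
  measurable_fun setT c -> (forall t, (0 <= c t)%R) ->
  measurable_fun setT l -> \int[lambda]_t (c t)%:E = C%:E ->
  distribution P X [set t | c t != expR (l t)] = 0 ->
  M.-integrable setT (EFin \o (fun z => p z * l z.1)%R) ->
  cond_diff_entropy P lambda mu X Y =
  - ((divergence M p (fun z => c z.1 * b z.2)%R +
      (1 - C%:E + \int[M]_z (p z * l z.1)%:E)) * ((ln 2)^-1)%:E).
Proof.
move=> mc c0 ml cC cl ipl.
have [qC iq] := integrable_pdf_prod mc c0 cC.
have mA : measurable [set t | c t != expR (l t)].
  have -> : [set t | c t != expR (l t)] = ~` ((fun t => c t - expR (l t))%R @^-1` [set 0%R]).
    apply/seteqP; split => t /=; first by move=> /eqP ct /eqP; rewrite subr_eq0 => /eqP.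
    by move=> ct; apply/eqP => ct'; apply: ct; rewrite ct' subrr.
  apply: measurableC; rewrite -[X in measurable X]setTI.
  by apply: measurable_funB => //; exact: measurableT_comp.
have cE := pdf_pair_null_fst mA cl.
rewrite (cond_diff_entropy_pdf pdfp pdfb).
have mq : measurable_fun setT (fun z : R * T2 => c z.1 * b z.2)%R.
  exact: measurable_fun_fst_snd.
rewrite (@integral_log2 _ _ _ M p (fun z => c z.1 * b z.2)%R mp mq p0 _ _
  (fun z => p z / b z.2)%R (fun z => l z.1)) //.
- by rewrite (pdf_integral1 pdfp) qC.
- by move=> z; rewrite mulr_ge0.
(* If [c = 0] then [c] differs from the positive number [exp l], so [p] vanishes; if [b = 0] then
   [p] vanishes as well. *)
- apply: filterS2 cE pdf_pair_null_snd => z cz bz /eqP.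
  rewrite mulf_eq0 => /orP[/eqP cz0|/eqP//]; apply: cz => /=.
  by rewrite cz0 eq_sym gt_eqF// expR_gt0.
- by apply: measurable_ratio => //; exact: measurableT_comp.
- exact: integrable_pdf pdfp.
(* Where [p > 0], also [b > 0] and [c = exp l], so [ln (p / b) = ln (p / (c b)) + l]; where [p = 0]
   both sides are 0. *)
- apply: filterS2 cE pdf_pair_null_snd => z cz bz.
  have [->|pz] := eqVneq (p z) 0%R; first by rewrite !mul0r addr0.
  have pz0 : (0 < p z)%R by rewrite lt_def pz p0.
  have bz0 : (0 < b z.2)%R.
    by rewrite lt_def b0 andbT; apply: contraNneq pz => /bz ->.
  have -> : c z.1 = expR (l z.1).
    by apply/eqP; apply: contraNT pz => /cz ->.
  rewrite -mulrDr; congr (_ * _)%R.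
  have -> : (p z / (expR (l z.1) * b z.2) = p z / b z.2 * expR (- l z.1))%R.
    by rewrite expRN invfM (mulrC (expR _)^-1%R) mulrA.
  by rewrite [in RHS]lnM ?posrE ?divr_gt0 ?expR_gt0// expRK subrK.
Qed.

(** The case [l = 0] of [integral_log2]: the masses of [p] and of [a b] are both 1 and cancel. *)
Lemma mutual_information_divergence (a : R -> R) : is_pdf P lambda X a ->
  mutual_information P lambda mu X Y =
  divergence M p (fun z => a z.1 * b z.2)%R * ((ln 2)^-1)%:E.
Proof.
move=> pdfa; have [ma a0 _] := pdfa.
have [q1 iq] := integrable_pdf_prod ma a0 (pdf_integral1 pdfa).
have mq : measurable_fun setT (fun z : R * T2 => a z.1 * b z.2)%R.
  exact: measurable_fun_fst_snd.
have mlog (u v : R * T2 -> R) : measurable_fun setT u ->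
    measurable_fun setT v ->
    measurable_fun setT (fun z => (u z * log2 (u z / v z))%:E).
  move=> mu_ mv; apply/measurable_EFinP/measurable_funM => //.
  by apply: measurable_funM => //; exact: measurable_log_ratio.
transitivity (\int[M]_z (p z * log2 (p z / (a z.1 * b z.2)))%:E).
  rewrite /mutual_information; apply: ae_eq_integral => //.
  - apply: mlog; first exact: measurable_density (pdf_has_density pdfp).
    apply: measurable_fun_fst_snd.
      exact: measurable_density (pdf_has_density pdfa).
    exact: measurable_density (pdf_has_density pdfb).
  - exact: mlog.
  - have := ae_snd lambda (pdf_density pdfb).
    have := ae_fst mu (pdf_density pdfa).
    have := pdf_density pdfp.
    by apply: filterS3 => z -> -> ->.
have i0 : M.-integrable setT (EFin \o (p \* cst 0)%R).
  rewrite (_ : _ \o _ = cst 0); first exact: integrable0.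
  by apply/funext => z /=; rewrite mulr0.
rewrite (@integral_log2 _ _ _ M p (fun z => a z.1 * b z.2)%R mp mq p0 _ _
  (fun z => p z / (a z.1 * b z.2))%R (cst 0%R))//.
- rewrite (pdf_integral1 pdfp) q1 subee// add0e.
  by under [X in _ + X]eq_integral do rewrite mulr0; rewrite integral0 adde0.
- by move=> z; rewrite mulr_ge0.
- have mA : measurable [set t | a t = 0%R] by exact: measurable_zero_set.
  apply: filterS2 (pdf_pair_null_fst mA (distribution_pdf_eq0 pdfa)) pdf_pair_null_snd.
  by move=> z az bz /eqP; rewrite mulf_eq0 => /orP[/eqP/az|/eqP/bz].
- exact: measurable_ratio.
- exact: integrable_pdf pdfp.
- by apply: filterS pdf_pair_null_snd => z _; rewrite mulr0 addr0.
Qed.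

End information_divergence.

(** * The deviation bound *)

Section deviation_bound.
Context d (T : measurableType d) (R : realType) (P : probability T R).
Context d2 (T2 : measurableType d2) (mu : {sigma_finite_measure set T2 -> \bar R}).
Variables (X : {mfun T >-> R}) (Y : {mfun T >-> T2}).
Local Notation lambda := (lebesgue_line R).
Local Notation M := (prod_measure lambda mu).
Hypothesis XYac : has_density P M (rv_pair X Y).
Hypothesis Yac : has_density P mu Y.
Hypothesis X0 : zero_mean P X.
Local Notation h := (cond_diff_entropy P lambda mu X Y).
Local Notation info := (mutual_information P lambda mu X Y).

(** Relative to [exp (- |t|)] the term [p l] is integrable because [X] is, so the entropy is a
    finite constant minus a nonnegative multiple of a divergence. *)
Lemma cond_diff_entropy_lty : h < +oo.
Proof.
have [p pdfp _] := has_density_pdf XYac.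
have [b pdfb _] := has_density_pdf Yac.
have [mp p0 _] := pdfp.
pose c (t : R) := expR (- `|t|); pose l (t : R) := (- `|t|)%R.
have ml : measurable_fun setT l.
  by apply: measurable_funN => //; exact: normr_measurable.
have mc : measurable_fun setT c by exact: measurableT_comp.
have c0 t : (0 <= c t)%R by exact: expR_ge0.
have [C cC] : exists C, \int[lambda]_t (c t)%:E = C%:E.
  have := @integral_expR_Nabs R.
  have : 0 <= \int[lambda]_t (c t)%:E by apply: integral_ge0 => t _; rewrite lee_fin.
  rewrite /c; case: (\int[lambda]_t _) => // r _ _; by exists r.
have ipl : M.-integrable setT (EFin \o (fun z => p z * l z.1)%R).
  apply/integrableP; split.
    apply/measurable_EFinP/measurable_funM => //; exact: measurableT_comp.
  have mn : measurable_fun setT (fun z : R * T2 => `|z.1|%R).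
    by apply: measurableT_comp => //; exact: normr_measurable.
  under eq_integral do rewrite /= /l mulrN normrN ger0_norm ?mulr_ge0//.
  rewrite (pdf_expectation pdfp mn)//.
  by have [/integrableP[_]] := X0.
rewrite (cond_diff_entropy_divergence pdfp pdfb mc c0 ml cC _ ipl); last first.
  rewrite (_ : [set t | _] = set0) ?measure0//.
  by apply/seteqP; split => t //=; rewrite /c eqxx.
have /fineK <- : \int[M]_z (p z * l z.1)%:E \is a fin_num.
  exact: integrable_fin_num ipl.
have := divergence_ge0 M p (fun z => c z.1 * b z.2)%R.
have ln2 : (0 < (ln 2)^-1 :> R)%R by rewrite invr_gt0 ln_gt0// ltr1n.
(* A finite divergence gives a real entropy, an infinite one gives [-oo]. *)
case: (divergence _ _ _) => [r _| |//]; first by rewrite ltry.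
by move=> _; rewrite addye// gt0_mulye ?lte_fin.
Qed.

(** The argument of [exp2e] is [h - 1] in the form it takes for the uniform reference on [[- D, D]]
    at divergence [v]. The power equals [D exp (- v)], and is 0 for infinite [v]. *)
Lemma exp2e_entropy_divergence (D : R) (v : \bar R) : (0 < D)%R -> 0 <= v ->
  exp2e (- ((v + (1 - 1%:E + (- ln (2 * D))%:E)) * ((ln 2)^-1)%:E) - 1) <= D%:E /\
  (exp2e (- ((v + (1 - 1%:E + (- ln (2 * D))%:E)) * ((ln 2)^-1)%:E) - 1) = D%:E <->
   v = 0).
Proof.
move=> D0.
have ln2 : (0 < ln 2 :> R)%R by rewrite ln_gt0// ltr1n.
have ln2V : (0 < (ln 2)^-1 :> R)%R by rewrite invr_gt0.
rewrite subee// add0e; case: v => [r|_|//]; last first.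
  rewrite addye// gt0_mulye ?lte_fin//=; split; first by rewrite lee_fin ltW.
  by split => // -[] D0'; move: D0; rewrite -D0' ltxx.
rewrite lee_fin => r0.
have -> : exp2e (- ((r%:E + (- ln (2 * D))%:E) * ((ln 2)^-1)%:E) - 1) =
    (D * expR (- r))%:E.
  transitivity (exp2e (- ((r + - ln (2 * D)) / ln 2) - 1)%R%:E) => //=.
  congr EFin.
  rewrite /powR pnatr_eq0/=.
  (* The [- 1] in the exponent cancels the factor 2 of [2 * D]. *)
  rewrite (_ : (_ * _ = ln D - r)%R) ?expRD ?lnK ?posrE//.
  rewrite mulrBl mul1r mulNr -mulrA mulVf ?gt_eqF// mulr1 lnM ?posrE//.
  by ring.
split.
  rewrite lee_fin; apply: ler_piMr; first exact: ltW.
  by rewrite -[leRHS]expR0 ler_expR oppr_le0.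
split=> [[]|[->]]; last by rewrite oppr0 expR0 mulr1.
rewrite -[RHS]mulr1 => /(mulfI (lt0r_neq0 D0)); rewrite -expR0 => /expR_inj.
by move/eqP; rewrite oppr_eq0 => /eqP ->.
Qed.

Lemma max_deviation_entropy :
  exp2e (h - 1) <= max_deviation P X /\
  (max_deviation P X = exp2e (h - 1) <-> uniform_rv P X /\ info = 0).
Proof.
have [p pdfp _] := has_density_pdf XYac.
have [b pdfb _] := has_density_pdf Yac.
have [mp p0 _] := pdfp; have [mb b0 _] := pdfb.
have Xac := has_density_fst XYac.
have ln2V : (0 < (ln 2)^-1 :> R)%R by rewrite invr_gt0 ln_gt0// ltr1n.
(* Stated for an arbitrary version [a] of the marginal density, so that the uniform density can be
   inserted later. *)
have I0 (a : R -> R) : is_pdf P lambda X a ->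
    info = 0 <-> {ae M, forall z, p z = (a z.1 * b z.2)%R}.
  move=> pdfa; have [ma a0 _] := pdfa.
  rewrite (mutual_information_divergence pdfp pdfb pdfa).
  have ab0 z : (0 <= a z.1 * b z.2)%R by rewrite mulr_ge0.
  have mab := measurable_fun_fst_snd ma mb.
  rewrite -(divergence_eq0 (mu := M) mp mab p0 ab0).
    split => [/eqP|->]; last by rewrite mul0e.
    by rewrite mule_eq0 => /orP[/eqP//|]; rewrite eqe gt_eqF.
  have mA : measurable [set t | a t = 0%R] by exact: measurable_zero_set.
  apply: filterS2 (pdf_pair_null_fst pdfp mA (distribution_pdf_eq0 pdfa))
    (pdf_pair_null_snd pdfp pdfb).
  by move=> z az bz /eqP; rewrite mulf_eq0 => /orP[/eqP/az|/eqP/bz].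
(* The zero mean centres the interval at 0, so its half-length is the maximum deviation. *)
have unif : uniform_rv P X -> exists D : R,
    [/\ (0 < D)%R, max_deviation P X = D%:E & is_pdf P lambda X (uniform_pdf (- D)%R D)].
  move=> /uniform_rv_pdf[a [D [aD suppE pdfu]]].
  have DE := pdf_uniform_mean aD X0 pdfu.
  have aE : a = (- D)%R by rewrite DE opprK.
  rewrite aE in aD suppE pdfu.
  have D0 : (0 < D)%R by lra.
  by exists D; split => //; apply: symmetric_max_deviation => //; exact: ltW.
have := max_deviation_gt0 Xac.
case XD : (max_deviation P X) => [D| |//]; rewrite ?lte_fin; last first.
  (* Infinite deviation: equality fails because the entropy is below [+oo], and a uniform variable
     has finite deviation. *)
  move=> _; split; first by rewrite leey.
  split; last by move=> [/unif[D []]]; rewrite XD.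
  by have := cond_diff_entropy_lty; case: h.
move=> D0.
(* The constant [l] is the logarithm of [c] only on [[- D, D]], outside of which [X] has probability
   0. *)
pose c := uniform_pdf (- D)%R D; pose l (t : R) := (- ln (2 * D))%R.
have ND : (- D < D)%R by lra.
have mc : measurable_fun setT c by exact: measurable_uniform_pdf.
have c0 t : (0 <= c t)%R by exact: uniform_pdf_ge0.
have ml : measurable_fun setT l by exact: measurable_cst.
have c1 : \int[lambda]_t (c t)%:E = 1%:E by exact: integral_uniform_pdf_line1.
have DD : (D - - D = 2 * D)%R by ring.
have expl : expR (- ln (2 * D)) = ((D - - D)^-1)%R.
  by rewrite expRN lnK ?DD// posrE mulr_gt0.
have plE z : ((p z * l z.1)%:E = (- ln (2 * D))%:E * (EFin \o p) z)%E.
  by rewrite /l -EFinM mulrC.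
have ip := integrable_pdf pdfp.
have ipl : M.-integrable setT (EFin \o (fun z => p z * l z.1)%R).
  by rewrite (_ : _ \o _ = fun z => (- ln (2 * D))%:E * (EFin \o p) z);
    [exact: integrableZl|apply/funext => z; exact: plE].
have clE : distribution P X [set t | c t != expR (l t)] = 0.
  rewrite -(distribution_gt_max_deviation XD); congr (distribution P X _).
  apply/seteqP; split => t /=; rewrite /c /l /uniform_pdf expl -ler_norml ltNge.
    by case: ifPn => // _; rewrite eqxx.
  by move=> /negbTE ->; rewrite eq_sym invr_eq0 DD mulf_neq0 ?pnatr_eq0// gt_eqF.
have hE := cond_diff_entropy_divergence pdfp pdfb mc c0 ml c1 clE ipl.
have plI : \int[M]_z (p z * l z.1)%:E = (- ln (2 * D))%:E.
  under eq_integral do rewrite plE.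
  by rewrite (integralZl measurableT ip) (pdf_integral1 pdfp) mule1.
rewrite plI in hE; rewrite hE.
set q := (fun z => c z.1 * b z.2)%R.
have mq : measurable_fun setT q by exact: measurable_fun_fst_snd.
have q0 z : (0 <= q z)%R by rewrite mulr_ge0.
have [le_D eq_D] := exp2e_entropy_divergence D0 (divergence_ge0 M p q).
split => //.
have mA : measurable [set t : R | (D < `|t|)%R].
  have -> : [set t | (D < `|t|)%R] = (fun t : R => `|t|%R) @^-1` `]D, +oo[%classic.
    by apply/seteqP; split => t /=; rewrite in_itv/= andbT.
  by rewrite -[A in measurable A]setTI; exact: normr_measurable.
(* The reference [q] vanishes only where [|z.1| > D] or [b = 0], and [p] is null on both sets. *)
have qp : {ae M, forall z, q z = 0%R -> p z = 0%R}.
  apply: filterS2 (pdf_pair_null_fst pdfp mA (distribution_gt_max_deviation XD))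
    (pdf_pair_null_snd pdfp pdfb).
  move=> z cz bz /eqP; rewrite /q mulf_eq0 => /orP[|/eqP/bz//].
  rewrite /c /uniform_pdf -ler_norml; case: ifPn => [_|nD _].
    by rewrite invr_eq0 DD mulf_eq0 pnatr_eq0/= (gt_eqF D0).
  by apply: cz; rewrite /= ltNge.
have div0 := divergence_eq0 mp mq p0 q0 qp.
split.
  (* Equality makes the divergence 0, hence [p = c b] almost everywhere; the first marginal is then
     [c], which gives uniformity and independence at once. *)
  move=> /esym/eq_D/div0 pq.
  have pdfc : is_pdf P lambda X c.
    exact: (pdf_fst mc c0 pdfb (ae_eq_pdf pdfp mq q0 pq)).
  by split; [exact: pdf_uniform_rv pdfc|apply/(I0 _ pdfc)].
(* Conversely, the half-length [D'] of the uniform law must equal [D], so [c] is the marginal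
   density and zero information says [p = c b]. *)
move=> [/unif[D' [D'0 XD' pdfu]] MI0].
have D'E : D' = D by move: XD'; rewrite XD => -[].
rewrite D'E in pdfu.
by apply/esym/eq_D/div0/(I0 _ pdfu).
Qed.

End deviation_bound.

(** * The bound for the prediction error *)

Theorem theorem5 (R : realType) (d : measure_display) (T : measurableType d)
    (P : probability T R) (x : nat -> {RV P >-> R})
    (x_cont : forall n, has_density P (lebesgue_tuple R n) (past x n))
    (x_mean0 : forall n, zero_mean P (x n))
    (k : nat) (f : {mfun k.-tuple R >-> R})
    (xhat_mean0 : zero_mean P (prediction x f)) :
  let h := cond_diff_entropy P (lebesgue_line R) (lebesgue_tuple R k)
             (x k) (past x k) in
  let e := prediction_error x f in
  exp2e (h - 1) <= max_deviation P e /\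
  (max_deviation P e = exp2e (h - 1) <->
   uniform_rv P e /\
   mutual_information P (lebesgue_line R) (lebesgue_tuple R k)
     e (past x k) = 0).
Proof.
move=> h e.
have eE w : e w = (x k w - f (past x k w))%R by [].
(* Index [k.+1] is taken because that vector contains [x k] along with its past. *)
have xac := has_density_next (x_cont k.+1).
have [p pdfp _] := has_density_pdf xac.
have eac := pdf_has_density (pdf_shear eE pdfp).
have e0 : zero_mean P e.
  have [ix xm] := x_mean0 k; have [iy ym] := xhat_mean0.
  rewrite unlock in xm ym.
  split; first by rewrite (_ : _ \o _ = (EFin \o x k) \- (EFin \o prediction x f));
    [exact: integrableB|].
  by rewrite unlock; transitivity (\int[P]_w ((x k w)%:E - (prediction x f w)%:E));
    [|rewrite integralB_EFin// xm ym sube0].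
(* The entropy of [x k] given the past becomes that of the error, so the bound for a pair [(X, Y)]
   applies with [X] the error. *)
rewrite /h (cond_diff_entropy_shear eE xac (x_cont k)).
exact: max_deviation_entropy.
Qed.
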